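(* Let $G$ be a simple graph of order $n$ and let $\sigma_1$ be its second smallest Laplacian eigenvalue. If $0<\sigma_1\le\frac12$, then $$\xi(G)\ge\sqrt{\frac{1-2\sigma_1}{\sigma_1}}.$$
   Context: The Laplacian matrix of $G$ is $L(G)=D(G)-A(G)$ (degree diagonal matrix minus adjacency matrix), with eigenvalues $0=\sigma_0\le\sigma_1\le\cdots\le\sigma_{n-1}$. A routing $R$ of $G$ is a set of $n(n-1)$ paths in $G$, one specified path from $u$ to $v$ for every ordered pair $(u,v)$ of distinct vertices. For a vertex $v$, $\xi(G,R,v)$ is the number of paths of $R$ passing through $v$ with $v$ not an end vertex. The vertex forwarding index is $\xi(G)=\min_R\max_{v\in V(G)}\xi(G,R,v)$. *)

(* Defs.v *)
From mathcomp Require Import all_boot all_order all_algebra.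
From mathcomp Require Import polyrcf.

Set Implicit Arguments.
Unset Strict Implicit.
Unset Printing Implicit Defensive.

Import Order.TTheory GRing.Theory Num.Theory.

Record sgraph := SGraph {
  vertex :> finType;
  adj : rel vertex;
  adj_sym : symmetric adj;
  adj_irrefl : irreflexive adj
}.
Arguments adj {s} _ _.

Section Laplacian.
Local Open Scope ring_scope.
Variables (R : rcfType) (G : sgraph).

Definition degree (u : G) : nat := #|[set v : G | adj u v]|.

(* Matrices are indexed by 'I_#|G| through the enumeration of the vertices. *)
Definition degree_mx : 'M[R]_#|G| :=
  diag_mx (\row_i (degree (enum_val i))%:R).

Definition adjacency_mx : 'M[R]_#|G| :=
  \matrix_(i, j) (adj (enum_val i) (enum_val j))%:R.

Definition laplacian_mx : 'M[R]_#|G| := degree_mx - adjacency_mx.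

(* The eigenvalues in nondecreasing order, repeated with multiplicity:
   rootsR is strictly increasing, and every root of the characteristic
   polynomial of a symmetric matrix lies in R. *)
Definition laplacian_spectrum : seq R :=
  let p := char_poly laplacian_mx in
  flatten [seq nseq (mup x p) x | x <- rootsR p].

(* The default value 0 is only used for k >= #|G|; in particular
   0 < laplacian_eigenvalue 1 excludes graphs of order at most 1. *)
Definition laplacian_eigenvalue (k : nat) : R := nth 0 laplacian_spectrum k.

End Laplacian.

Section Forwarding.
Variable G : sgraph.

(* The vertices of the path are u :: p; a path repeats no vertex. *)
Definition is_path (u w : G) (p : seq G) : bool :=
  [&& path adj u p, last u p == w & uniq (u :: p)].

(* A family of candidate paths, each stored without its first vertex. As paths
   repeat no vertex, the bound #|G| on the length loses none of them. *)
Definition path_family : finType := {ffun G * G -> {bseq #|G| of G}}.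

(* The values on pairs (u, u) are irrelevant here and in xi_at. *)
Definition is_routing (P : path_family) : bool :=
  [forall u : G, forall w : G, (u != w) ==> is_path u w (P (u, w))].

Definition xi_at (P : path_family) (v : G) : nat :=
  #|[set uw : G * G | [&& uw.1 != uw.2, v != uw.1, v != uw.2
                        & v \in (P uw : seq G)]]|.

Definition xi_max (P : path_family) : nat := \max_(v : G) xi_at P v.

(* The minimum of xi_max over all routings. A disconnected graph has no
   routing; it gets the junk value 0. *)
Definition vertex_forwarding_index : nat :=
  if [pick P | is_routing P] is Some P0
  then xi_max [arg min_(P < P0 | is_routing P) xi_max P]
  else 0.

End Forwarding.

(* Main.v *)
Require Import Defs.
From mathcomp Require Import all_boot all_order all_algebra.
From mathcomp Require Import polyrcf ring lra zify.

Import Order.TTheory GRing.Theory Num.Theory.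
Local Open Scope ring_scope.

(* An eigenvector f for sigma1 > 0 sums to 0, so that 2 n |f|^2 is the sum of
   (f u - f w)^2 over all ordered pairs. By Cauchy-Schwarz each term is at most
   n times the sum of the squared increments of f along the path of the routing
   from u to w. If this path uses the arc (x, y), then x or y is one of its
   interior vertices or (u, w) = (x, y), so each arc is used at most 2 xi + 1
   times. As the squared increments over all arcs sum to 2 sigma1 |f|^2, this
   gives 1 <= (2 xi + 1) sigma1, i.e. (1 - 2 sigma1) / sigma1 <= 2 xi - 1, and
   2 xi - 1 <= xi^2.
   If G had no routing it would be disconnected, the indicators of two
   components would put 0 at least twice in the spectrum, and sigma1 <= 0. *)

(** * Quadratic identities and Cauchy-Schwarz along a path *)

(** Each square splits as [f x * (f x - f y) + f y * (f y - f x)], and exchanging [x] and [y] turns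
    one half into the other. For [a] the adjacency relation, the right side is twice the quadratic
    form of the Laplacian. *)
Lemma sum_weighted_sqr_diff (R : comPzRingType) (T : finType)
    (a : T -> T -> R) (f : T -> R) :
    (forall x y, a x y = a y x) ->
  \sum_x \sum_y a x y * (f x - f y) ^+ 2 =
  2 * \sum_x f x * \sum_y a x y * (f x - f y).
Proof.
move=> asym.
have swap : \sum_x f x * (\sum_y a x y * (f x - f y)) =
            \sum_x \sum_y a x y * (f y * (f y - f x)).
  rewrite exchange_big; apply: eq_bigr => x _; rewrite big_distrr /=.
  by apply: eq_bigr => y _; rewrite asym; ring.
rewrite mulr_natl mulr2n {2}swap -big_split; apply: eq_bigr => x _ /=.
rewrite big_distrr -big_split; apply: eq_bigr => y _ /=; ring.
Qed.

Lemma sum_sqr_diff (R : comPzRingType) (T : finType) (f : T -> R) :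
    \sum_x f x = 0 ->
  \sum_x \sum_y (f x - f y) ^+ 2 = 2 * #|T|%:R * \sum_x f x ^+ 2.
Proof.
move=> f0.
have := @sum_weighted_sqr_diff R T (fun _ _ => 1) f (fun _ _ => erefl).
under eq_bigr => x _ do under eq_bigr => y _ do rewrite mul1r.
move=> ->; rewrite -mulrA; congr (2 * _); rewrite big_distrr /=.
apply: eq_bigr => x _; under eq_bigr => y _ do rewrite mul1r.
rewrite sumrB f0 subr0 sumr_const -mulr_natl; ring.
Qed.

Lemma sqr_telescope_le (R : realFieldType) (T : Type) (f : T -> R) u p :
  (f u - f (last u p)) ^+ 2 <=
  (size p)%:R * \sum_(s <- zip (u :: p) p) (f s.1 - f s.2) ^+ 2.
Proof.
elim: p u => [|v p IH] u /=; first by rewrite subrr expr0n mul0r.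
rewrite big_cons /=; move: (IH v).
set S := \sum_(s <- _) _; set b := f v - f _.
have S0 : 0 <= S by apply: sumr_ge0 => s _; exact: sqr_ge0.
have -> : f u - f (last v p) = (f u - f v) + b by rewrite /b; ring.
(* The main argument multiplies by [c = size p], so length 0 is treated apart: there the induction
   hypothesis forces [b = 0]. *)
move: (f u - f v) => a; case: (size p) => [|k] hb.
  have b0 : b = 0.
    by apply/eqP; rewrite -sqrf_eq0 eq_le sqr_ge0 andbT -(mul0r S).
  by rewrite b0 addr0 mul1r lerDl.
have k0 : 0 < k.+1%:R :> R by rewrite ltr0n.
rewrite -(nat1r k.+1); move: k.+1%:R k0 hb => c c0 hb.
rewrite -(ler_pM2l c0) -subr_ge0.
(* The difference is a square plus a nonnegative multiple of the slack in the induction hypothesis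
   [b ^+ 2 <= c * S]. *)
have -> : c * ((1 + c) * (a ^+ 2 + S)) - c * (a + b) ^+ 2 =
          (c * a - b) ^+ 2 + (c * S - b ^+ 2) * (1 + c) by ring.
rewrite addr_ge0 ?sqr_ge0 // mulr_ge0 ?subr_ge0 //.
by rewrite addr_ge0 ?ler01 ?ltW.
Qed.

Lemma mem_zip_belast (T : eqType) (x y u : T) p :
    (x, y) \in zip (u :: p) p ->
  (x \in u :: p) && (y \in p).
Proof.
elim: p u => [//|v p IH] u; rewrite [zip _ _]/= in_cons => /orP[/eqP[-> ->]|].
  by rewrite !inE !eqxx.
move/IH/andP=> [hx hy]; apply/andP; split.
  by move: hx; rewrite !inE => ->; rewrite orbT.
by move: hy; rewrite !inE => ->; rewrite orbT.
Qed.

Lemma mem_zip_neq_last (T : eqType) (x y u : T) p :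
  uniq (u :: p) -> (x, y) \in zip (u :: p) p -> x != last u p.
Proof.
elim: p u => [//|v p IH] u.
rewrite [zip _ _]/= in_cons cons_uniq => /andP[up Up].
case/orP=> [/eqP[-> _]|]; last exact: IH.
by apply: contraNneq up => ->; exact: (mem_last v p).
Qed.

Lemma path_zip (T : eqType) (e : rel T) (x y u : T) p :
  path e u p -> (x, y) \in zip (u :: p) p -> e x y.
Proof.
elim: p u => [//|v p IH] u /= /andP[uv vp]; rewrite inE.
by case/orP=> [/eqP[-> ->]//|]; exact: IH.
Qed.

(** * Multiplicity of the eigenvalue 0 and connectedness *)

(** For a suitable invertible [P], the rows of [P *m A] from index [\rank A] on vanish. The same
    rows of [P ('X - A)] are then ['X] times rows of [P], and the determinant releases one factor
    ['X] for each of them. *)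
Lemma dvdp_char_poly_rank (F : fieldType) n (A : 'M[F]_n) :
  ('X ^+ (n - \rank A) %| char_poly A)%R.
Proof.
pose P := invmx (col_ebase A).
pose d : 'rV[{poly F}]_n := \row_i (if (i < \rank A)%N then 1 else 'X).
have [B defB B0] : exists2 B, B = P *m A &
    forall (i j : 'I_n), (i < \rank A)%N = false -> B i j = 0.
  exists (P *m A) => // i j hi; rewrite -[A in P *m A]mulmx_ebase !mulmxA.
  rewrite mulVmx ?col_ebase_unit // mul1mx mxE big1 // => k _.
  by rewrite mxE hi andbF mul0r.
pose M : 'M[{poly F}]_n := \matrix_(i, j)
  (if (i < \rank A)%N then 'X * (P i j)%:P - (B i j)%:P else (P i j)%:P).
have factor : map_mx polyC P *m char_poly_mx A = diag_mx d *m M.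
  rewrite /char_poly_mx mulmxBr -map_mxM -defB -scalemx1 -scalemxAr mulmx1.
  apply/matrixP=> i j; rewrite mul_diag_mx !mxE.
  by case: ifP => [_|/B0->]; rewrite ?mul1r // subr0.
have unitP : \det (map_mx polyC P) %= 1.
  rewrite det_map_mx -[1]/(1%:P) polyC_eqp1 //.
  by rewrite -unitfE -unitmxE unitmx_inv col_ebase_unit.
have -> : ('X ^+ (n - \rank A) %| char_poly A) =
          ('X ^+ (n - \rank A) %| \det (map_mx polyC P) * char_poly A).
  by apply: eqp_dvdr; rewrite -{1}[char_poly A]mul1r eqp_mulr // eqp_sym.
rewrite /char_poly -det_mulmx factor det_mulmx det_diag dvdp_mulr //.
under eq_bigr => i _ do rewrite mxE -if_neg -leqNgt.
by rewrite -big_mkcond -(big_geq_mkord _ _ xpredT (fun=> 'X)) prodr_const_nat.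
Qed.

(** By the rank bound, 0 is a root of multiplicity at least 2. Index 1 of the spectrum thus falls
    either among the negative roots listed before 0 or in the block of zeros. *)
Lemma laplacian_spectrum1_le0 (R : rcfType) (G : sgraph) :
    (\rank (laplacian_mx R G) + 2 <= #|G|)%N ->
  laplacian_eigenvalue R G 1 <= 0.
Proof.
move=> hr; rewrite /laplacian_eigenvalue /laplacian_spectrum.
set p := char_poly _; set F := fun x => nseq (mup x p) x.
have p0 : p != 0 by apply/monic_neq0/char_poly_monic.
have mu0 : (1 < mup 0 p)%N.
  rewrite mup_geq // subr0; apply: dvdp_trans (dvdp_char_poly_rank _ _ _).
  by rewrite dvdp_exp2l // leq_subRL ?rank_leq_row.
have : 0 \in rootsR p.
  rewrite -roots_on_rootsR // in_itv /=; apply/factor_theorem/dvdpP.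
  by rewrite XsubC_dvd // ltnW.
have := sorted_roots (- cauchy_bound p) (cauchy_bound p) p.
rewrite -/(rootsR p) => srt in0; case/splitPr: in0 srt => s1 s2.
rewrite sorted_cat_cons => /andP[srt _].
have neg1 x : x \in s1 -> x < 0.
  move: srt; rewrite -cats1 sorted_pairwise; last exact: lt_trans.
  rewrite pairwise_cat allrel1r => /and3P[/allP h _ _]; exact: h.
rewrite map_cat flatten_cat nth_cat; case: ltnP => [lt1|ge1].
  have /flattenP[_ /mapP[x xs1 ->]] := mem_nth 0 lt1.
  by move/nseqP=> [-> _]; exact/ltW/neg1.
rewrite /= nth_cat size_nseq (leq_ltn_trans (leq_subr _ _) mu0).
by rewrite nth_nseq if_same.
Qed.

Lemma mulmx_laplacian (R : rcfType) (G : sgraph) m (A : 'M[R]_(m, #|G|)) i x :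
  (A *m laplacian_mx R G) i (enum_rank x) =
  \sum_y (adj x y)%:R * (A i (enum_rank x) - A i (enum_rank y)).
Proof.
rewrite mulmxBr mul_mx_diag !mxE enum_rankK.
under [RHS]eq_bigr => y _ do rewrite mulrBr.
rewrite sumrB -big_distrl /= [X in X - _]mulrC; congr (_ * _ - _).
  rewrite /degree cardsE -sum1_card natr_sum big_mkcond.
  by apply: eq_bigr => y _; rewrite (_ : (y \in adj x) = adj x y) //; case: (adj x y).
rewrite (reindex enum_rank); last exact/onW_bij/enum_rank_bij.
by apply: eq_bigr => y _; rewrite mxE !enum_rankK adj_sym mulrC.
Qed.

(** The rows of [M] are the indicators of the components of [u] and [w]. The Laplacian kills both,
    as no edge leaves a component, so its kernel has dimension at least 2. *)
Lemma rank_laplacian_disconnected (R : rcfType) (G : sgraph) (u w : G) :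
    ~~ connect adj u w -> (\rank (laplacian_mx R G) + 2 <= #|G|)%N.
Proof.
move=> uw; pose c (i : 'I_2) := if i == 0 then u else w.
pose M : 'M[R]_(2, #|G|) := \matrix_(i, j) (connect adj (c i) (enum_val j))%:R.
have csym : connect_sym (@adj G) by apply/sym_connect_sym/adj_sym.
have ML : M *m laplacian_mx R G = 0.
  apply/matrixP=> i j; rewrite -(enum_valK j) mulmx_laplacian [RHS]mxE.
  rewrite big1 // => y _.
  rewrite !mxE !enum_rankK; case: (boolP (adj _ y)) => [/connect1 xy|].
    by rewrite (same_connect_r csym xy) subrr mulr0.
  by rewrite mul0r.
have : row_free M.
  (* This right inverse selects the columns of [u] and [w], where [M] restricts to the identity. *)
  apply/row_freeP; exists (\matrix_(j, k) (enum_val j == c k)%:R).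
  apply/matrixP=> i k; rewrite !mxE (bigD1 (enum_rank (c k))) //= big1 ?addr0.
    rewrite !mxE enum_rankK eqxx mulr1; congr (_%:R).
    have [-> |ik] := eqVneq i k; first by rewrite connect0.
    rewrite /c; case: (eqVneq i 0) ik => [->|i0]; case: (eqVneq k 0) => [_|k0] //.
    - by rewrite (negbTE uw).
    - by rewrite csym (negbTE uw).
    by case/eqP; apply/val_inj; move: i k i0 k0 => [[|[|//]] ?] [[|[|//]] ?].
  move=> j jk; rewrite !mxE; case: eqP => [hj|]; last by rewrite mulr0.
  by rewrite -hj enum_valK eqxx in jk.
move/eqP=> rM; have := mxrankS (introT sub_kermxP ML).
rewrite rM mxrank_ker => h; have := rank_leq_row (laplacian_mx R G); lia.
Qed.

(** * Routings and the Poincaré inequality *)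

Lemma ex_routing (G : sgraph) :
  (forall u w : G, connect adj u w) -> exists P : path_family G, is_routing P.
Proof.
move=> conn.
have ex (uw : G * G) : exists b : {bseq #|G| of G}, is_path uw.1 uw.2 b.
  have /connectP[p pp ->] := conn uw.1 uw.2.
  case: (shortenP pp) => q pq Uq _.
  have szq : (size q <= #|G|)%N.
    by rewrite -(card_uniqP (_ : uniq q)) ?max_card //; case/andP: Uq.
  by exists (Bseq szq); rewrite /is_path pq Uq eqxx.
exists [ffun uw => xchoose (ex uw)].
apply/forallP=> u; apply/forallP=> w; apply/implyP=> _; rewrite ffunE.
exact: (xchooseP (ex (u, w))).
Qed.

(** As a path repeats no vertex, an arc [(x, y)] on it never starts at the last vertex nor ends at
    the first. So [x] is interior unless [x = u], and [y] is interior unless [y = w]. *)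
Lemma card_routes_through_arc (G : sgraph) (P : path_family G) (x y : G) :
    is_routing P ->
  (#|[set uw : G * G | (uw.1 != uw.2) &&
       ((x, y) \in zip (uw.1 :: P uw) (P uw))]| <= (2 * xi_max P).+1)%N.
Proof.
move=> routP; pose S v := [set uw : G * G | [&& uw.1 != uw.2, v != uw.1,
  v != uw.2 & v \in (P uw : seq G)]].
have hS v : (#|S v| <= xi_max P)%N by exact: (leq_bigmax (F := xi_at P) v).
apply: (@leq_trans #|(x, y) |: (S x :|: S y)|); last first.
  apply: leq_trans (leq_card_setU _ _) _; rewrite cards1 add1n ltnS mul2n -addnn.
  by apply: leq_trans (leq_card_setU _ _) _; exact: leq_add.
apply/subset_leq_card/subsetP=> -[u w]; rewrite !inE /= => /andP[uw xy].
rewrite uw /=; move/forallP/(_ u)/forallP/(_ w)/implyP/(_ uw): routP.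
case/and3P=> _ /eqP lw Up; have /andP[xp yp] := mem_zip_belast _ _ _ _ _ xy.
have := mem_zip_neq_last _ _ _ _ _ Up xy; rewrite lw => xw.
have yu : y != u by apply: contraTneq yp => ->; case/andP: Up.
rewrite yp andbT xw yu /=; move: xp; rewrite inE xpair_eqE (eq_sym u) (eq_sym w).
by case: eqVneq => //= _; case: eqVneq => //= _ ->.
Qed.

Lemma poincare_routing (R : realFieldType) (G : sgraph) (P : path_family G)
    (f : G -> R) :
    is_routing P ->
  \sum_u \sum_w (f u - f w) ^+ 2 <=
  #|G|%:R * (2 * xi_max P).+1%:R *
    \sum_x \sum_y (adj x y)%:R * (f x - f y) ^+ 2.
Proof.
move=> routP.
pose arcs uw := zip (uw.1 :: P uw) (P uw).
(* Summing over all pairs [s] with an indicator prepares the exchange of sums. The test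
   [uw.1 != uw.2] discards the arbitrary values of [P] on the diagonal, and the [adj] factor is 1 on
   every arc of a path. *)
have route uw : (f uw.1 - f uw.2) ^+ 2 <= #|G|%:R * \sum_(s : G * G)
    ((uw.1 != uw.2) && (s \in arcs uw))%:R *
      ((adj s.1 s.2)%:R * (f s.1 - f s.2) ^+ 2).
  have sum_ge0 (b : G * G -> bool) : 0 <= \sum_(s : G * G)
     (b s)%:R * ((adj s.1 s.2)%:R * (f s.1 - f s.2) ^+ 2).
    by apply: sumr_ge0 => s _; rewrite mulr_ge0 ?ler0n //
      mulr_ge0 ?ler0n ?sqr_ge0.
  case: uw => u w /=; case: (eqVneq u w) => [-> |uw].
    by rewrite subrr expr0n mulr_ge0 ?ler0n ?sum_ge0.
  move/forallP/(_ u)/forallP/(_ w)/implyP/(_ uw): routP.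
  case/and3P=> hp /eqP lw Up; rewrite -{1}lw.
  apply: le_trans (sqr_telescope_le _ _ _ _ _) _.
  (* A path without repeated vertices uses each arc at most once, so the sum along it is a sum over
     a set. *)
  have -> : \sum_(s <- zip (u :: P (u, w)) (P (u, w))) (f s.1 - f s.2) ^+ 2 =
     \sum_(s : G * G) (s \in arcs (u, w))%:R *
       ((adj s.1 s.2)%:R * (f s.1 - f s.2) ^+ 2).
    rewrite big_uniq ?zip_uniql // big_mkcond; apply: eq_bigr => -[x y] _ /=.
    rewrite /arcs /=.
    case: (boolP (_ \in _)) => [/(path_zip _ _ _ _ _ _ hp) ->|_].
      by rewrite !mul1r.
    by rewrite mul0r.
  by rewrite ler_wpM2r ?sum_ge0 // ler_nat size_bseq.
rewrite !pair_big /=; apply: le_trans (ler_sum _ (fun uw _ => route uw)) _.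
rewrite -big_distrr -mulrA ler_wpM2l ?ler0n // exchange_big big_distrr /=.
apply: ler_sum => -[x y] _ /=; rewrite -big_distrl /=.
rewrite ler_wpM2r //.
  by apply: mulr_ge0; [exact: ler0n | exact: sqr_ge0].
rewrite -natr_sum ler_nat.
apply: leq_trans (card_routes_through_arc _ _ x y routP).
rewrite -sum1_card [leqRHS]big_mkcond; apply/eq_leq/eq_bigr => uw _ /=.
by rewrite inE /arcs; case: ifP.
Qed.

(** * From an eigenvector to the forwarding index *)

Lemma routing_eigenvalue_bound (R : rcfType) (G : sgraph) (P : path_family G)
    (s : R) :
    is_routing P -> root (char_poly (laplacian_mx R G)) s -> s != 0 ->
  1 <= (2 * xi_max P).+1%:R * s.
Proof.
move=> routP; rewrite -eigenvalue_root_char => /eigenvalueP[v vL v0] s0.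
pose f x := v 0 (enum_rank x).
have Lf x : s * f x = \sum_y (adj x y)%:R * (f x - f y).
  by rewrite -mulmx_laplacian vL mxE.
have sum_f : \sum_x f x = 0.
  apply: (mulfI s0); rewrite mulr0 big_distrr /=.
  under eq_bigr => x _ do rewrite Lf.
  (* The summand is antisymmetric in [x] and [y], so the double sum added to its exchanged copy
     cancels term by term. *)
  apply/eqP; rewrite -[_ == 0](mulrn_eq0 _ 2) /=.
  rewrite mulr2n {2}exchange_big -big_split big1 // => x _.
  rewrite -big_split big1 // => y _ /=; rewrite adj_sym; ring.
have f2 : 0 < \sum_x f x ^+ 2.
  rewrite lt0r sumr_ge0 ?andbT => [|x _]; last exact: sqr_ge0.
  apply: contra v0; rewrite psumr_eq0 => [/allP h|x _]; last exact: sqr_ge0.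
  apply/eqP/rowP=> j; rewrite mxE -(enum_valK j); apply/eqP.
  by have := h (enum_val j) (mem_index_enum _); rewrite /= sqrf_eq0.
have n0 : 0 < #|G|%:R :> R.
  rewrite ltr0n lt0n; apply: contraTneq f2 => /eqP n0; rewrite big1 ?ltxx // => x _.
  by have := card0_eq (eqP n0) x.
have := poincare_routing _ _ P f routP; rewrite sum_sqr_diff //.
rewrite (@sum_weighted_sqr_diff R G (fun x y => (adj x y)%:R)); last first.
  by move=> x y; rewrite adj_sym.
have -> : \sum_x f x * (\sum_y (adj x y)%:R * (f x - f y)) =
          s * \sum_x f x ^+ 2.
  by rewrite big_distrr; apply: eq_bigr => x _; rewrite -Lf /=; ring.
move: ((2 * xi_max P).+1%:R) => c h.
have nf : 0 < 2 * #|G|%:R * (\sum_x f x ^+ 2).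
  by apply: mulr_gt0 f2; apply: mulr_gt0 n0; rewrite ltr0n.
rewrite -(ler_pM2l nf) mulr1; apply: (le_trans h).
by rewrite le_eqVlt; apply/orP; left; apply/eqP; ring.
Qed.

Theorem theorem4p2 (R : rcfType) (G : sgraph) :
  let sigma1 : R := laplacian_eigenvalue R G 1 in
  0 < sigma1 -> sigma1 <= 1 / 2 ->
  Num.sqrt ((1 - 2 * sigma1) / sigma1) <= (vertex_forwarding_index G)%:R.
Proof.
move=> sigma1 sigma1_gt0 _; have sigma1_neq0 := lt0r_neq0 sigma1_gt0.
have conn (u w : G) : connect adj u w.
  apply: contraTT sigma1_gt0 => uw; rewrite -leNgt.
  exact: laplacian_spectrum1_le0 (rank_laplacian_disconnected _ _ _ _ uw).
have rootP : root (char_poly (laplacian_mx R G)) sigma1.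
  have in_spec : sigma1 \in laplacian_spectrum R G.
    (* With fewer than two entries, [sigma1] would be the default 0 of [nth]; being positive, it is
       a genuine eigenvalue. *)
    apply: mem_nth; rewrite ltnNge; apply: contraTN sigma1_gt0 => sz.
    by rewrite /sigma1 /laplacian_eigenvalue nth_default ?ltxx.
  have /flattenP[_ /mapP[x xs ->]] := in_spec; move/nseqP=> [-> _].
  have p0 := monic_neq0 (char_poly_monic (laplacian_mx R G)).
  by move: xs; rewrite -(roots_on_rootsR p0) => /andP[].
(* Connectedness rules out the branch with the junk value 0. *)
rewrite /vertex_forwarding_index; case: pickP => [P0 routP0|none]; last first.
  by have [P] := ex_routing _ conn; rewrite none.
case: arg_minnP => // P routP _.
have := routing_eigenvalue_bound _ _ _ _ routP rootP sigma1_neq0.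
rewrite -natr1 natrM; move: (xi_max P)%:R (ler0n R (xi_max P)) => xi xi0 bound.
rewrite -[leRHS](ger0_norm xi0) -sqrtr_sqr ler_wsqrtr // ler_pdivrMr //.
apply: (@le_trans _ _ ((2 * xi - 1) * sigma1)); first by lra.
rewrite ler_wpM2r ?(ltW sigma1_gt0) // -subr_ge0.
have -> : xi ^+ 2 - (2 * xi - 1) = (xi - 1) ^+ 2 by ring.
exact: sqr_ge0.
Qed.
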